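(* Let $(A,\le,0,1)$ be a bounded poset satisfying both the Ascending Chain Condition and the Descending Chain Condition, let $(T,R)$ be a time frame with $R$ serial, and let $P,F,H,G$ be the tense operators induced by $(T,R)$. Then for all $B,C\in\mathcal P_+(A^T)$: (1) $P(B\odot B)=P(B)$ and $F(B\odot B)=F(B)$; (2) $\operatorname{Max}L(P(B\odot C))\le_1\operatorname{Max}L(P(B))\odot\operatorname{Max}L(P(C))$; (3) $\operatorname{Max}L(F(B\odot C))\le_1\operatorname{Max}L(F(B))\odot\operatorname{Max}L(F(C))$.
   Context: ACC: no infinite strictly ascending chains; DCC: no infinite strictly descending chains. For $X\subseteq A$: $L(X)$, $U(X)$ the sets of lower/upper bounds, $\operatorname{Max}X,\operatorname{Min}X$ the maximal/minimal elements. $\mathcal P_+(X)$ = nonempty subsets. For subsets $X,Y$: $X\le Y$ iff $x\le y$ for all $x\in X,y\in Y$; $X\le_1Y$ iff every $x\in X$ lies below some $y\in Y$; $X\le_2Y$ iff every $y\in Y$ lies above some $x\in X$. Connectives: for $x,y\in A$, $x\odot y=\operatorname{Max}L(\{x,y\})$; for nonempty $B,C\subseteq A$, $B\odot C=\operatorname{Max}\{a\in A\mid a\le U(\bigcup\{b\odot c\mid b\in B,c\in C\})\}$. For $B,C\in(\mathcal P_+A)^T$, $(B\odot C)(t)=B(t)\odot C(t)$; for $B\subseteq A^T$, $B(t)=\{q(t)\mid q\in B\}$, so $B\odot C$ is defined for $B,C\in\mathcal P_+(A^T)$ as the function $t\mapsto B(t)\odot C(t)$. For a function $Z$ from $T$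 to subsets of $A$, $L(Z)$ and $\operatorname{Max}L(Z)$ are taken pointwise, and $\le_1$ between such functions is pointwise in $t$. A time frame is $(T,R)$, $T\ne\emptyset$, $R\subseteq T^2$; serial: each $s$ has $r,t$ with $rRs$, $sRt$. The induced tense operators $P,F,H,G:\mathcal P_+(A^T)\to(\mathcal P_+A)^T$ are $P(B)(s)=\operatorname{Min}U(\{q(t)\mid q\in B, tRs\})$, $F(B)(s)=\operatorname{Min}U(\{q(t)\mid q\in B, sRt\})$, $H(B)(s)=\operatorname{Max}L(\{q(t)\mid q\in B,tRs\})$, $G(B)(s)=\operatorname{Max}L(\{q(t)\mid q\in B,sRt\})$. An element $Z\in(\mathcal P_+A)^T$ is fed to these operators as the subset $\{q\in A^T\mid q(t)\in Z(t)\ \forall t\}$ of $A^T$. *)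

(* Defs.v *)
From mathcomp Require Import all_boot all_order.
From mathcomp Require Import boolp classical_sets.

Set Implicit Arguments.
Unset Strict Implicit.
Unset Printing Implicit Defensive.

Import Order.TTheory.
Local Open Scope classical_set_scope.
Local Open Scope order_scope.

(* U(X) and L(X) are the library's [ubound X] and [lbound X]. *)

Definition ACC_on {d} (A : porderType d) : Prop :=
  ~ exists f : nat -> A, forall n, f n < f n.+1.

Definition DCC_on {d} (A : porderType d) : Prop :=
  ~ exists f : nat -> A, forall n, f n.+1 < f n.

Section Poset.
Context {d : Order.disp_t} {A : porderType d}.
Implicit Types (X Y B C : set A) (x y a b c : A).

Definition Maxs X : set A := [set a | X a /\ forall b, X b -> ~ (a < b)].

Definition Mins X : set A := [set a | X a /\ forall b, X b -> ~ (b < a)].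

Definition le1 X Y : Prop := forall x, X x -> exists2 y, Y y & x <= y.

Definition odot_elt x y : set A := Maxs (lbound [set x; y]).

(* The set {a | a <= U(X)} is L(U(X)). *)
Definition odot B C : set A :=
  Maxs (lbound (ubound (\bigcup_(b in B) \bigcup_(c in C) odot_elt b c))).

End Poset.

Section Tense.
Context {d : Order.disp_t} {A : porderType d} {T : Type}.
Implicit Types (Z W : T -> set A) (B C : set (T -> A)) (s t : T).

Definition vals B : T -> set A := fun t => [set q t | q in B].

Definition fodot Z W : T -> set A := fun t => odot (Z t) (W t).

Definition sodot B C : T -> set A := fodot (vals B) (vals C).

Definition fMaxL Z : T -> set A := fun t => Maxs (lbound (Z t)).

Definition fle1 Z W : Prop := forall t, le1 (Z t) (W t).

(* The subset of A^T as which an element of (P_+ A)^T is fed to P, F, H, G. *)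
Definition selections Z : set (T -> A) := [set q | forall t, Z t (q t)].

Definition serial (R : T -> T -> Prop) : Prop :=
  forall s, (exists r, R r s) /\ (exists t, R s t).

Definition past_vals (R : T -> T -> Prop) B s : set A :=
  [set a | exists q t, [/\ B q, R t s & a = q t]].

Definition future_vals (R : T -> T -> Prop) B s : set A :=
  [set a | exists q t, [/\ B q, R s t & a = q t]].

Definition tenseP R B : T -> set A := fun s => Mins (ubound (past_vals R B s)).
Definition tenseF R B : T -> set A := fun s => Mins (ubound (future_vals R B s)).
Definition tenseH R B : T -> set A := fun s => Maxs (lbound (past_vals R B s)).
Definition tenseG R B : T -> set A := fun s => Maxs (lbound (future_vals R B s)).

End Tense.

(* Under ACC and DCC the values of all these operations are nonempty, so
   using [set _] for their codomains agrees with P_+(A) and P_+(A^T). *)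

Lemma ACC_Maxs_above d (A : porderType d) (X : set A) x :
  ACC_on A -> X x -> exists2 m, Maxs X m & x <= m.
Proof.
move=> acc Xx; apply: contrapT => nom; apply: acc.
pose S := {a : A | X a /\ x <= a}.
have step (u : S) : {v : S | sval u < sval v}.
  apply: cid; case: u => a [Xa xa] /=; apply: contrapT => nov; apply: nom.
  exists a => //; split=> // b Xb ab; apply: nov.
  by exists (exist _ b (conj Xb (le_trans xa (ltW ab)))).
have [f [_ fS]] := dependent_choice step (exist _ x (conj Xx (lexx x)) : S).
by exists (fun n => sval (f n)).
Qed.

Lemma DCC_Mins_below d (A : porderType d) (X : set A) x :
  DCC_on A -> X x -> exists2 m, Mins X m & m <= x.
Proof.
move=> dcc Xx; apply: contrapT => nom; apply: dcc.
pose S := {a : A | X a /\ a <= x}.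
have step (u : S) : {v : S | sval v < sval u}.
  apply: cid; case: u => a [Xa ax] /=; apply: contrapT => nov; apply: nom.
  exists a => //; split=> // b Xb ba; apply: nov.
  by exists (exist _ b (conj Xb (le_trans (ltW ba) ax))).
have [f [_ fS]] := dependent_choice step (exist _ x (conj Xx (lexx x)) : S).
by exists (fun n => sval (f n)).
Qed.

Section Nonempty.
Context {d : Order.disp_t} {A : tbPOrderType d} {T : Type}.
Hypotheses (acc : ACC_on A) (dcc : DCC_on A).

Lemma MaxsL_neq0 (X : set A) : Maxs (lbound X) !=set0.
Proof.
have L0 : lbound X \bot by move=> x _; exact: le0x.
by have [m Mm _] := ACC_Maxs_above acc L0; exists m.
Qed.

Lemma MinsU_neq0 (X : set A) : Mins (ubound X) !=set0.
Proof.
have U1 : ubound X \top by move=> x _; exact: lex1.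
by have [m Mm _] := DCC_Mins_below dcc U1; exists m.
Qed.

Lemma tenseP_neq0 (R : T -> T -> Prop) B s : tenseP (A := A) R B s !=set0.
Proof. exact: MinsU_neq0. Qed.

Lemma tenseF_neq0 (R : T -> T -> Prop) B s : tenseF (A := A) R B s !=set0.
Proof. exact: MinsU_neq0. Qed.

Lemma tenseH_neq0 (R : T -> T -> Prop) B s : tenseH (A := A) R B s !=set0.
Proof. exact: MaxsL_neq0. Qed.

Lemma tenseG_neq0 (R : T -> T -> Prop) B s : tenseG (A := A) R B s !=set0.
Proof. exact: MaxsL_neq0. Qed.

Lemma odot_neq0 (B C : set A) : odot B C !=set0.
Proof. exact: MaxsL_neq0. Qed.

Lemma selections_neq0 (Z : T -> set A) :
  (forall t, Z t !=set0) -> selections Z !=set0.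
Proof. by move=> /choice[q Zq]; exists q. Qed.

End Nonempty.

(* Main.v *)
(** Under ACC, [B odot C] is the set of maximal elements of the
    Dedekind-MacNeille closure [L U (down B `&` down C)].  Since
    [U (Max X) = U X] and [U L U = U], the set [B odot C] has the same upper
    bounds as [down B `&` down C], and [B odot B] the same ones as [B].  As
    [F(B)] at [s] only depends on the sets [U(B(t))] with [s R t], this gives
    [F(B odot B) = F(B)] and shows that [Max L F(B odot C)] is below both
    [Max L F(B)] and [Max L F(C)] for [<=_1].  Finally, [X <=_1 B] and
    [X <=_1 C] together mean [X `<=` down B `&` down C], so that
    [X <=_1 B odot C].  The operator [P] is [F] for the converse relation. *)

Require Import Defs.
From mathcomp Require Import all_boot all_order.
From mathcomp Require Import boolp classical_sets.

Import Order.TTheory.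
Local Open Scope order_scope.
Local Open Scope classical_set_scope.

Section Bounds.
Context {d : Order.disp_t} {A : porderType d}.
Implicit Types (X Y : set A).

Lemma subset_ubound X Y : X `<=` Y -> ubound Y `<=` ubound X.
Proof. by move=> XY u Uu x /XY /Uu. Qed.

Lemma subset_lbound X Y : X `<=` Y -> lbound Y `<=` lbound X.
Proof. by move=> XY l Ll x /XY /Ll. Qed.

Lemma sub_lbound_ubound X : X `<=` lbound (ubound X).
Proof. by move=> x Xx u; apply. Qed.

Lemma ubound_lbound_ubound X : ubound (lbound (ubound X)) = ubound X.
Proof.
apply/seteqP; split; first exact: subset_ubound (@sub_lbound_ubound X).
by move=> u Uu x; exact: ub_lb_ub.
Qed.

Lemma ubound_bigcup (I : Type) (D : set I) (F : I -> set A) :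
  ubound (\bigcup_(i in D) F i) = \bigcap_(i in D) ubound (F i).
Proof.
apply/seteqP; split=> u Uu; first by move=> i Di x Fx; apply: Uu; exists i.
by move=> x [i Di Fx]; exact: Uu Fx.
Qed.

Lemma sub_down X : X `<=` down X.
Proof. by move=> x Xx; exists x. Qed.

Lemma ubound_down X : ubound (down X) = ubound X.
Proof.
apply/seteqP; split; first exact: subset_ubound (@sub_down X).
by move=> u Uu x [y [/Uu yu xy]]; exact: le_trans xy yu.
Qed.

Lemma le1_down X Y : le1 X Y <-> X `<=` down Y.
Proof. by split=> XY x Xx; apply/downP; exact: XY. Qed.

Lemma Maxs_sub X : Maxs X `<=` X.
Proof. by move=> x []. Qed.

End Bounds.

Section AscendingChains.
Context {d : Order.disp_t} {A : porderType d}.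
Hypothesis acc : ACC_on A.
Implicit Types (X Y B C : set A).

Lemma le1_Maxs X Y : X `<=` Y -> le1 X (Maxs Y).
Proof. by move=> XY x /XY; exact: ACC_Maxs_above. Qed.

Lemma ubound_Maxs X : ubound (Maxs X) = ubound X.
Proof.
apply/seteqP; split; last exact: subset_ubound (@Maxs_sub _ _ X).
rewrite -(ubound_down (Maxs X)); apply: subset_ubound.
by apply/le1_down; exact: le1_Maxs.
Qed.

Lemma down_bigcup_odot_elt B C :
  down (\bigcup_(b in B) \bigcup_(c in C) odot_elt b c) = down B `&` down C.
Proof.
apply/seteqP; split=> x.
- move=> [a [[b Bb [c Cc [La _]]] xa]]; split; [exists b|exists c]; split=> //.
  + by apply: le_trans xa (La _ _); left.
  + by apply: le_trans xa (La _ _); right.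
- move=> [[b [Bb xb]] [c [Cc xc]]].
  have Lx : lbound [set b; c] x by move=> _ [] ->.
  have [m mbc xm] := ACC_Maxs_above acc Lx.
  by exists m; split=> //; exists b => //; exists c.
Qed.

Lemma odotE B C : odot B C = Maxs (lbound (ubound (down B `&` down C))).
Proof. by rewrite -down_bigcup_odot_elt ubound_down. Qed.

Lemma ubound_odot B C : ubound (odot B C) = ubound (down B `&` down C).
Proof. by rewrite odotE ubound_Maxs ubound_lbound_ubound. Qed.

Lemma ubound_odot_l B C : ubound B `<=` ubound (odot B C).
Proof.
by rewrite ubound_odot -(ubound_down B); apply: subset_ubound; exact: subIsetl.
Qed.

Lemma ubound_odot_r B C : ubound C `<=` ubound (odot B C).
Proof.
by rewrite ubound_odot -(ubound_down C); apply: subset_ubound; exact: subIsetr.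
Qed.

Lemma ubound_odotxx B : ubound (odot B B) = ubound B.
Proof. by rewrite ubound_odot setIid ubound_down. Qed.

Lemma le1_odot X B C : le1 X B -> le1 X C -> le1 X (odot B C).
Proof.
move=> /le1_down XB /le1_down XC; rewrite odotE; apply: le1_Maxs.
by apply: subset_trans (@sub_lbound_ubound _ _ _); rewrite subsetI.
Qed.

End AscendingChains.

Lemma lbound_Mins {d : Order.disp_t} {A : porderType d} (X : set A) :
  DCC_on A -> lbound (Mins X) = lbound X.
Proof. by move=> dcc; exact: (@ubound_Maxs _ A^d dcc X). Qed.

Section Tense.
Context {d : Order.disp_t} {A : porderType d} {T : Type}.
Implicit Types (R : T -> T -> Prop) (B C : set (T -> A)) (Z : T -> set A).

Lemma vals_selections Z : (forall t, Z t !=set0) -> vals (selections Z) = Z.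
Proof.
move=> /choice[q Zq]; apply/funext => t; apply/seteqP.
split=> [_ [p Zp <-]|a Zta]; first exact: Zp.
exists (fun r => if pselect (r = t) then a else q r); last by case: pselect.
by move=> r; case: pselect => [rt|_] /=; [rewrite rt|exact: Zq].
Qed.

Lemma future_vals_bigcup R B s :
  future_vals R B s = \bigcup_(t in R s) vals B t.
Proof.
apply/seteqP; split=> a.
  by move=> [q [t [Bq Rst ->]]]; exists t => //; exists q.
by move=> [t Rst [q Bq <-]]; exists q, t.
Qed.

Lemma ubound_future_vals R B s :
  ubound (future_vals R B s) = \bigcap_(t in R s) ubound (vals B t).
Proof. by rewrite future_vals_bigcup ubound_bigcup. Qed.

Lemma eq_tenseF R B C :
  (forall t, ubound (vals B t) = ubound (vals C t)) -> tenseF R B = tenseF R C.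
Proof.
move=> BC; apply/funext => s; rewrite /tenseF !ubound_future_vals.
by congr Mins; apply: eq_bigcapr => t _; exact: BC.
Qed.

Lemma fle1_fMaxL_tenseF R B C : ACC_on A -> DCC_on A ->
  (forall t, ubound (vals C t) `<=` ubound (vals B t)) ->
  fle1 (fMaxL (tenseF R B)) (fMaxL (tenseF R C)).
Proof.
move=> acc dcc CB s; rewrite /fMaxL !lbound_Mins//; apply: le1_Maxs => //.
apply: subset_trans (@Maxs_sub _ _ _) _; apply: subset_lbound.
by rewrite !ubound_future_vals; apply: subset_bigcap => t _; exact: CB.
Qed.

Lemma tenseP_converse R B : tenseP R B = tenseF (fun s t => R t s) B.
Proof. by []. Qed.

End Tense.

Section TenseOdot.
Context {d : Order.disp_t} {A : tbPOrderType d} {T : Type}.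
Hypothesis acc : ACC_on A.
Implicit Types (R : T -> T -> Prop) (B C : set (T -> A)).

Lemma vals_sodot B C : vals (selections (sodot B C)) = sodot B C.
Proof. by apply: vals_selections => t; exact: odot_neq0. Qed.

Lemma tenseF_sodotxx R B : tenseF R (selections (sodot B B)) = tenseF R B.
Proof. by apply: eq_tenseF => t; rewrite vals_sodot; exact: ubound_odotxx. Qed.

Lemma fMaxL_tenseF_sodot R B C : DCC_on A ->
  fle1 (fMaxL (tenseF R (selections (sodot B C))))
       (fodot (fMaxL (tenseF R B)) (fMaxL (tenseF R C))).
Proof.
move=> dcc s; apply: le1_odot => //; apply: fle1_fMaxL_tenseF => // t;
  rewrite vals_sodot.
- exact: ubound_odot_l.
- exact: ubound_odot_r.
Qed.

End TenseOdot.

Theorem theorem6p4 (d : Order.disp_t) (A : tbPOrderType d)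
  (hACC : ACC_on A) (hDCC : DCC_on A)
  (T : Type) (hT : inhabited T) (R : T -> T -> Prop) (hR : serial R)
  (B C : set (T -> A)) (hB : B !=set0) (hC : C !=set0) :
  (tenseP R (selections (sodot B B)) = tenseP R B /\
   tenseF R (selections (sodot B B)) = tenseF R B) /\
  fle1 (fMaxL (tenseP R (selections (sodot B C))))
       (fodot (fMaxL (tenseP R B)) (fMaxL (tenseP R C))) /\
  fle1 (fMaxL (tenseF R (selections (sodot B C))))
       (fodot (fMaxL (tenseF R B)) (fMaxL (tenseF R C))).
Proof.
rewrite !tenseP_converse; split; split.
- exact: tenseF_sodotxx.
- exact: tenseF_sodotxx.
- exact: fMaxL_tenseF_sodot.
- exact: fMaxL_tenseF_sodot.
Qed.
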